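(* The system $\mathsf{AX}_{\text{comp}}$ is sound and complete: a formula $\varphi\in\mathcal{L}_{\text{comp}}$ is derivable in $\mathsf{AX}_{\text{comp}}$ if and only if $\varphi$ is true in every probability model.
   Context: Let $\mathsf{Prop}$ be a nonempty set of proposition letters; $\sigma(\mathsf{Prop})$ is the set of all Boolean combinations over $\mathsf{Prop}$. $\mathcal{L}_{\text{comp}}$ is the set of Boolean combinations (via $\neg,\wedge$, with the other connectives as the usual abbreviations) of atoms $\mathbf{P}(\alpha)\succsim\mathbf{P}(\beta)$ with $\alpha,\beta\in\sigma(\mathsf{Prop})$; one writes $\alpha\succsim\beta$ for $\mathbf{P}(\alpha)\succsim\mathbf{P}(\beta)$, and $\alpha\approx\beta$ for $\alpha\succsim\beta\wedge\beta\succsim\alpha$. Here $\bot$ is any Boolean contradiction and $\top$ any Boolean tautology in $\sigma(\mathsf{Prop})$. A (probability) model is $\mathfrak{M}=(\Omega,\mathcal{F},\mathbb{P},[\![\cdot]\!])$ with $(\Omega,\mathcal{F},\mathbb{P})$ a probability space and $[\![\cdot]\!]:\sigma(\mathsf{Prop})\to\wp(\Omega)$ a Boolean valuation (connectives interpreted by the corresponding set operations) with $[\![A]\!]\in\mathcal{F}$ for each $A\in\mathsf{Prop}$; $\mathfrak{M}\models\alpha\succsim\beta$ iff $\mathbb{P}([\![\alpha]\!])\geq\mathbb{P}([\![\beta]\!])$, and Boolean combinations are evaluated as usual. $\mathsf{AX}_{\text{base}}$ consists of: $\mathsf{Lin}$ (transitivity and comparability of $\succsim$); $\mathsf{Bool}$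 (Boolean reasoning); $\mathsf{Dist}$ ($\alpha\succsim\beta$ whenever $\beta\to\alpha$ is a propositional tautology); $\mathsf{NonDeg}$ ($\neg(\bot\succsim\top)$). $\mathsf{AX}_{\text{comp}}$ consists of the axioms and rules of $\mathsf{AX}_{\text{base}}$ plus the following axiom scheme and rule: $\mathsf{Quasi}$: $\alpha\succsim\beta\leftrightarrow(\alpha\wedge\neg\beta)\succsim(\beta\wedge\neg\alpha)$; $\mathsf{Polarize}$: from $(\alpha\wedge A)\approx(\alpha\wedge\neg A)\to\varphi$ infer $\varphi$, where $A$ is a proposition letter that occurs nowhere in $\alpha$ or $\varphi$.
   Formalization: The set Prop of proposition letters is assumed infinite rather than merely nonempty: with three letters Polarize lacks fresh letters, and the negation of the description of the Kraft-Pratt-Seidenberg order on five cells is valid but not derivable. *)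

(* Defs.v *)
From HB Require Import structures.
From mathcomp Require Import all_boot all_order all_algebra.
From mathcomp Require Import all_classical all_reals all_analysis.
Set Implicit Arguments.
Unset Strict Implicit.
Unset Printing Implicit Defensive.

Local Open Scope classical_set_scope.

(* The set sigma(Prop) of Boolean combinations of letters.  Negation and
   conjunction are the primitive connectives; there is no primitive bottom or
   top, these being arbitrary contradictions and tautologies. *)
Inductive bform (L : Type) : Type :=
| BVar of L
| BNeg of bform L
| BAnd of bform L & bform L.

Definition bimp (L : Type) (a b : bform L) : bform L := BNeg (BAnd a (BNeg b)).

Fixpoint beval (L : Type) (v : L -> bool) (a : bform L) : bool :=
  match a with
  | BVar p => v p
  | BNeg a1 => ~~ beval v a1
  | BAnd a1 a2 => beval v a1 && beval v a2
  end.

Definition btaut (L : Type) (a : bform L) : Prop := forall v, beval v a = true.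
Definition bcontra (L : Type) (a : bform L) : Prop :=
  forall v, beval v a = false.

Fixpoint bletters (L : Type) (a : bform L) : set L :=
  match a with
  | BVar p => [set p]
  | BNeg a1 => bletters a1
  | BAnd a1 a2 => bletters a1 `|` bletters a2
  end.

(* [CGe a b] is the atom P(a) >~ P(b). *)
Inductive cform (L : Type) : Type :=
| CGe of bform L & bform L
| CNeg of cform L
| CAnd of cform L & cform L.

Definition cor (L : Type) (f g : cform L) : cform L :=
  CNeg (CAnd (CNeg f) (CNeg g)).
Definition cimp (L : Type) (f g : cform L) : cform L := CNeg (CAnd f (CNeg g)).
Definition ciff (L : Type) (f g : cform L) : cform L :=
  CAnd (cimp f g) (cimp g f).
Definition capprox (L : Type) (a b : bform L) : cform L :=
  CAnd (CGe a b) (CGe b a).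

(* Here [v] assigns truth values to comparison atoms, which are treated as
   propositionally independent. *)
Fixpoint ceval (L : Type) (v : bform L -> bform L -> bool) (f : cform L)
    : bool :=
  match f with
  | CGe a b => v a b
  | CNeg f1 => ~~ ceval v f1
  | CAnd f1 f2 => ceval v f1 && ceval v f2
  end.

Definition ctaut (L : Type) (f : cform L) : Prop := forall v, ceval v f = true.

Fixpoint cletters (L : Type) (f : cform L) : set L :=
  match f with
  | CGe a b => bletters a `|` bletters b
  | CNeg f1 => cletters f1
  | CAnd f1 f2 => cletters f1 `|` cletters f2
  end.

(* Boolean reasoning (Bool) is rendered as all propositional tautologies over
   comparison atoms together with modus ponens. *)
Inductive AXcomp (L : Type) : cform L -> Prop :=
| Bool_taut f : ctaut f -> AXcomp f
| Bool_mp f g : AXcomp (cimp f g) -> AXcomp f -> AXcomp g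
| Lin_trans a b c : AXcomp (cimp (CAnd (CGe a b) (CGe b c)) (CGe a c))
| Lin_comp a b : AXcomp (cor (CGe a b) (CGe b a))
| Dist a b : btaut (bimp b a) -> AXcomp (CGe a b)
| NonDeg bot top : bcontra bot -> btaut top -> AXcomp (CNeg (CGe bot top))
| Quasi a b :
    AXcomp (ciff (CGe a b) (CGe (BAnd a (BNeg b)) (BAnd b (BNeg a))))
| Polarize a f (p : L) :
    ~ bletters a p -> ~ cletters f p ->
    AXcomp (cimp (capprox (BAnd a (BVar p)) (BAnd a (BNeg (BVar p)))) f) ->
    AXcomp f.

Record prob_model (R : realType) (L : Type) := ProbModel {
  pm_disp : measure_display;
  pm_space : measurableType pm_disp;
  pm_prob : probability pm_space R;
  pm_val : bform L -> set pm_space;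
  pm_val_neg : forall a, pm_val (BNeg a) = ~` pm_val a;
  pm_val_and : forall a b, pm_val (BAnd a b) = pm_val a `&` pm_val b;
  pm_val_meas : forall p, measurable (pm_val (BVar p))
}.

Arguments pm_val {R L} M a : rename.

Fixpoint sat (R : realType) (L : Type) (M : prob_model R L) (f : cform L)
    : Prop :=
  match f with
  | CGe a b => (pm_prob M (pm_val M b) <= pm_prob M (pm_val M a))%E
  | CNeg f1 => ~ sat M f1
  | CAnd f1 f2 => sat M f1 /\ sat M f2
  end.

(* Main.v *)
Require Import Defs.
From HB Require Import structures.
From mathcomp Require Import all_boot all_order all_algebra.
From mathcomp Require Import all_classical all_reals all_analysis.
From mathcomp Require Import ring lra.
Set Implicit Arguments.
Unset Strict Implicit.
Unset Printing Implicit Defensive.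
Import Order.TTheory GRing.Theory Num.Theory.

(** Soundness is routine except for the polarization rule. Given a model that
    refutes the conclusion, its product with a fair coin, where the fresh
    letter is read as heads, satisfies the premise's antecedent because heads
    halves every event of the original model; and it agrees with that model on
    all formulas without the fresh letter.

    For completeness, an underivable [f] is false under some assignment [v] of
    truth values to comparison atoms that makes all derivable formulas true
    ([lindenbaum]). Such a [v] is a qualitative probability: a total preorder
    on events, monotone for inclusion and additive over disjoint unions
    ([cmp_add], [cmp_sum]). It remains to represent [v], on the finite algebra
    generated by the letters of [f], by a probability measure. This is a
    finite homogeneous system of linear inequalities in the masses of the
    atoms of that algebra, with coefficients in {-1, 0, 1}, and by
    Fourier-Motzkin elimination ([fourier_motzkin]) it can only fail to have a
    solution if some of its inequalities, one of them strict, have left-hand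
    sides adding up to zero. In terms of events: there are comparisons
    [A_i >= B_i], one of them strict, such that every atom lies in as many
    [A_i] as [B_i].

    That is excluded by polarization ([finite_cancellation]): applied
    repeatedly, it allows trading [v] for an assignment with the same
    comparisons [A_i >= B_i] in which every atom [s] is split into arbitrarily
    many equally likely pieces [(s, j)]. Let the slice [A^j] of an event [A]
    consist of the [j]-th pieces of its atoms. As all slices of [A] are equally
    likely, [A >= B] amounts to [A^j >= B^j], with the same strictness. With
    different slices for different [i], the events [A_i^i] are disjoint, so
    that additivity makes their union strictly more likely than the union of
    the [B_i^i]. But both unions contain equally many pieces of every atom, and
    are therefore equally likely. *)

(** * Soundness *)

Section Soundness.
Local Open Scope classical_set_scope.
Local Open Scope ereal_scope.
Variables (R : realType) (L : Type).
Implicit Type M : prob_model R L.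

Lemma sat_ceval M f :
  sat M f <->
  ceval (fun a b => pm_prob M (pm_val M b) <= pm_prob M (pm_val M a)) f.
Proof.
elim: f => [a b|f IHf|f IHf g IHg] //=; first by rewrite IHf; split=> /negP.
by rewrite IHf IHg; split=> /andP.
Qed.

Definition letters_at M (x : pm_space M) : L -> bool :=
  fun q => `[< pm_val M (BVar q) x >].

Lemma pm_valE M a : pm_val M a = [set x | beval (letters_at x) a].
Proof.
elim: a => [q|a IHa|a IHa b IHb].
- by apply/seteqP; split=> x /asboolP.
- by rewrite pm_val_neg IHa; apply/seteqP; split=> x /= /negP.
- by rewrite pm_val_and IHa IHb; apply/seteqP; split=> x /= /andP.
Qed.

Lemma pm_val_measurable M a : measurable (pm_val M a).
Proof.
elim: a => [q|a IHa|a IHa b IHb]; first exact: pm_val_meas.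
  by rewrite pm_val_neg; exact: measurableC.
by rewrite pm_val_and; exact: measurableI.
Qed.

(** The probabilities of [a] and [b] exceed those of [a /\ ~ b] and [b /\ ~ a]
    by the same finite amount, the probability of [a /\ b]. *)
Lemma sat_quasi M a b :
  sat M (ciff (CGe a b) (CGe (BAnd a (BNeg b)) (BAnd b (BNeg a)))).
Proof.
apply/sat_ceval => /=; set P := pm_prob M.
have split_val c d : P (pm_val M c) =
    P (pm_val M (BAnd c (BNeg d))) + P (pm_val M (BAnd c d)).
  have mval := pm_val_measurable M.
  rewrite -(measureU P (mval _) (mval _)); last first.
    rewrite !pm_valE; apply/seteqP; split=> x //=.
    by move=> [/andP[_ /negP nd] /andP[_]].
  congr (P _); rewrite !pm_valE; apply/seteqP; split=> x /=.
    by case: (beval _ c); case: (beval _ d) => // _; [right|left].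
  by case=> /andP[].
have -> : (P (pm_val M b) <= P (pm_val M a)) =
    (P (pm_val M (BAnd b (BNeg a))) <= P (pm_val M (BAnd a (BNeg b)))).
  rewrite (split_val b a) (split_val a b).
  have -> : pm_val M (BAnd b a) = pm_val M (BAnd a b).
    by rewrite !pm_val_and setIC.
  by rewrite leeD2rE // fin_num_measure //; exact: pm_val_measurable.
by case: (_ <= _).
Qed.

(* The product of a model with a fair coin, the letter [p] reading off the
   outcome of the coin. *)
Section Coin.
Variables (M : prob_model R L) (p : L).

Let coin : probability bool R := bernoulli_prob 2^-1%R.

Definition coin_letters (x : pm_space M * bool) : L -> bool :=
  fun q => if `[< q = p >] then x.2 else letters_at x.1 q.

Definition coin_val (a : bform L) : set (pm_space M * bool) :=
  [set x | beval (coin_letters x) a].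

Lemma coin_val_neg a : coin_val (BNeg a) = ~` coin_val a.
Proof. by apply/seteqP; split=> x /= /negP. Qed.

Lemma coin_val_and a b : coin_val (BAnd a b) = coin_val a `&` coin_val b.
Proof. by apply/seteqP; split=> x /= /andP. Qed.

Lemma coin_valE a : ~ bletters a p -> coin_val a = pm_val M a `*` setT.
Proof.
move=> pa; rewrite pm_valE.
suff E x : beval (coin_letters x) a = beval (letters_at x.1) a.
  by apply/seteqP; split=> x; rewrite /coin_val /= E // => -[].
elim: a pa => [q|a IHa|a IHa b IHb] /=.
- move=> qp; rewrite /coin_letters; case: asboolP => // qp'.
  by case: qp; rewrite qp'.
- by move=> /IHa ->.
- by move=> /not_orP[/IHa -> /IHb ->].
Qed.

Lemma coin_val_p : coin_val (BVar p) = setT `*` [set true].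
Proof.
apply/seteqP; split=> -[x b]; rewrite /coin_val /= /coin_letters asboolT //=.
by case.
Qed.

Lemma coin_val_meas q : measurable (coin_val (BVar q)).
Proof.
have [->|qp] := pselect (q = p).
  by rewrite coin_val_p; exact: measurableX.
rewrite coin_valE /= => [|/esym//]; apply: measurableX => //.
exact: pm_val_measurable.
Qed.

Definition coin_model : prob_model R L :=
  @ProbModel R L _ _ (pm_prob M \x coin) _
    coin_val_neg coin_val_and coin_val_meas.

Lemma sat_coin_model f : ~ cletters f p -> sat coin_model f <-> sat M f.
Proof.
have E a : ~ bletters a p ->
    (pm_prob M \x coin) (coin_val a) = pm_prob M (pm_val M a).
  move=> pa; rewrite coin_valE // product_measure1E //.
    by rewrite [X in _ * X](probability_setT coin) mule1.
  exact: pm_val_measurable.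
elim: f => [a b|f IHf|f IHf g IHg] /=.
- by move=> /not_orP[pa pb]; rewrite !E.
- by move=> /IHf ->.
- by move=> /not_orP[/IHf -> /IHg ->].
Qed.

Lemma sat_coin_approx a : ~ bletters a p ->
  sat coin_model (capprox (BAnd a (BVar p)) (BAnd a (BNeg (BVar p)))).
Proof.
move=> pa; rewrite /capprox /= !coin_val_and coin_val_neg coin_val_p.
rewrite coin_valE //.
have half b : coin [set b] = (2^-1%R)%:E.
  rewrite -[LHS]/(bernoulli_prob 2^-1%R [set b]) bernoulli_probE; last first.
    by rewrite invr_ge0 ler0n /= invf_le1 ?ler1n ?ltr0n.
  rewrite /unstable.onem !diracE; case: b; rewrite !in_set1 /=.
    by rewrite mule1 mule0 adde0.
  by rewrite mule1 mule0 add0e; congr (_%:E); lra.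
have E b : (pm_prob M \x coin) (pm_val M a `*` [set b]) =
    pm_prob M (pm_val M a) * (2^-1%R)%:E.
  rewrite product_measure1E //; last exact: pm_val_measurable.
  by congr (_ * _); exact: half.
have -> : ~` (setT `*` [set true]) = (setT : set (pm_space M)) `*` [set false].
  apply/seteqP; split=> -[x [|]] /=;
  first [by case=> *; discriminate | by move=> _ [] | by case | by split].
by rewrite -!setXI !setIT !setTI !E.
Qed.

End Coin.

Lemma soundness f : AXcomp f -> forall M, sat M f.
Proof.
elim=> {f} [f tf|f g _ IHfg _ IHf|a b c|a b|a b ba|bot top fbot ttop|a b|
            a f p pa pf _ IHf] M.
- by apply/sat_ceval.
- have := IHfg M; have := IHf M; rewrite !sat_ceval /= => -> /=.
  by rewrite negbK.
- apply/sat_ceval => /=; apply/negP => /andP[/andP[ab bc]].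
  by rewrite (le_trans bc ab).
- by apply/sat_ceval => /=; rewrite negb_and !negbK le_total.
- rewrite /= le_measure ?inE; [by []|exact: pm_val_measurable..|].
  rewrite !pm_valE => x /=; have /= := ba (letters_at x).
  by case: (beval _ b) => //=; rewrite negbK.
- rewrite /= !pm_valE.
  have -> : [set x : pm_space M | beval (letters_at x) bot] = set0.
    by apply/seteqP; split=> x //=; rewrite fbot.
  have -> : [set x : pm_space M | beval (letters_at x) top] = setT.
    by apply/seteqP; split=> x //=; rewrite ttop.
  by rewrite measure0 probability_setT lee_fin ler10.
- exact: sat_quasi.
apply/(sat_coin_model M pf); apply: contrapT => nf.
by apply: (IHf (coin_model M p)); split=> //; exact: sat_coin_approx.
Qed.

End Soundness.

(** * Qualitative probabilities that refute underivable formulas *)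

Section Lindenbaum.
Local Open Scope classical_set_scope.

Definition theorem_valuation (L : Type) (v : bform L -> bform L -> bool) :=
  forall h, AXcomp h -> ceval v h = true.

(** An ultrafilter on truth assignments commutes with the connectives; the
    assignment of its limit truth values is thus an ultraproduct. *)
Lemma ultrafilter_truth (L : Type) (U : set_system (bform L -> bform L -> bool))
    (f : cform L) : UltraFilter U ->
  ceval (fun a b => `[< U [set v | v a b] >]) f = `[< U [set v | ceval v f] >].
Proof.
move=> UU; elim: f => [a b|f IHf|f IHf g IHg] //=.
- rewrite IHf; apply/idP/asboolP.
    move=> /asboolPn nUf.
    have [//|UnF] := in_ultra_setVsetC [set v | ceval v f] UU.
    by apply: filterS UnF => v /= /negP.
  move=> UnF; apply/asboolPn => Uf.
  suff [v /= [/negP]] : [set v | ~~ ceval v f] `&` [set v | ceval v f] !=set0.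
    by [].
  exact: filter_ex (filterI UnF Uf).
- rewrite IHf IHg; apply/andP/asboolP.
    by move=> [/asboolP Uf /asboolP Ug]; apply: filterS2 Uf Ug => v /= -> ->.
  by move=> Ufg; split; apply/asboolP; apply: filterS Ufg => v /= /andP[].
Qed.

Lemma AXcomp_and (L : Type) (f g : cform L) :
  AXcomp f -> AXcomp g -> AXcomp (CAnd f g).
Proof.
move=> ff gg; apply: Bool_mp gg; apply: Bool_mp ff; apply: Bool_taut => v /=.
by case: (ceval v f); case: (ceval v g).
Qed.

(** Derivability of [h] and underivability of [f] leave some truth assignment
    satisfying [h] and not [f], by propositional reasoning alone. Hence the sets
    of these assignments, for [h] derivable, generate a proper filter; an
    ultrafilter that contains it yields one assignment for all [h] at once. *)
Lemma lindenbaum (L : Type) (f : cform L) : ~ AXcomp f ->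
  exists2 v, theorem_valuation v & ceval v f = false.
Proof.
move=> nf.
pose F : set_system (bform L -> bform L -> bool) :=
  [set A | exists2 h, AXcomp h & [set v | ceval v h && ~~ ceval v f] `<=` A].
have top_taut : AXcomp (cimp f f).
  by apply: Bool_taut => v /=; rewrite andbN.
have FF : ProperFilter F.
  apply: Build_ProperFilter_ex.
    move=> A [h Hh sub]; have [[v Hv]|none] := pselect
      (exists v, ceval v h && ~~ ceval v f); first by exists v; apply: sub.
    exfalso; apply/nf/(Bool_mp _ Hh)/Bool_taut => v /=.
    by apply/negP => hv; apply: none; exists v.
  split.
  - by exists (cimp f f).
  - move=> A B [h Hh sA] [g Hg sB]; exists (CAnd h g).
      exact: AXcomp_and.
    move=> v /= /andP[/andP[vh vg] vf]; split.
      by apply: sA; rewrite /= vh.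
    by apply: sB; rewrite /= vg.
  - by move=> A B AB [h Hh sA]; exists h => // v /sA /AB.
have [U [UU FU]] := ultraFilterLemma FF.
exists (fun a b => `[< U [set v | v a b] >]).
  move=> h Hh; rewrite ultrafilter_truth; apply/asboolP/FU.
  by exists h => // v /= /andP[].
rewrite ultrafilter_truth; apply/asboolP => Uf.
have : F [set v | ~~ ceval v f] by exists (cimp f f) => // v /= /andP[].
move=> /FU Unf.
suff [v /= [->]] : [set v | ceval v f] `&` [set v | ~~ ceval v f] !=set0 by [].
exact: filter_ex (filterI Uf Unf).
Qed.

End Lindenbaum.

(* Events are Boolean formulas up to equivalence. That [x] is the disjoint union
   of the [X i] is expressed by one numerical identity,
   [\sum_i beval w (X i) = beval w x] for every [w]. *)
Section QualitativeProbability.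
Variables (L : Type) (v : bform L -> bform L -> bool).
Hypothesis thv : theorem_valuation v.
Implicit Types a b c x y z t : bform L.

Lemma cmp_trans b a c : v a b -> v b c -> v a c.
Proof.
move=> ab bc; have /= := thv (Lin_trans a b c).
by rewrite ab bc; case: (v a c).
Qed.

Lemma cmp_total a b : v a b || v b a.
Proof. by have /= := thv (Lin_comp a b); rewrite negb_and !negbK. Qed.

Lemma cmp_mono a b : (forall w, beval w b -> beval w a) -> v a b.
Proof.
move=> ba; apply: (thv (@Dist _ a b _)) => w /=.
by have := ba w; case: (beval w b) => // ->.
Qed.

Lemma cmp_congr a b a' b' :
  (forall w, beval w a = beval w a') -> (forall w, beval w b = beval w b') ->
  v a b = v a' b'.
Proof.
move=> aa bb; apply/idP/idP => [ab|ab].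
  apply: (@cmp_trans a); first by apply: cmp_mono => w; rewrite aa.
  by apply: (cmp_trans ab); apply: cmp_mono => w; rewrite bb.
apply: (@cmp_trans a'); first by apply: cmp_mono => w; rewrite aa.
by apply: (cmp_trans ab); apply: cmp_mono => w; rewrite bb.
Qed.

Lemma cmp_quasi a b : v a b = v (BAnd a (BNeg b)) (BAnd b (BNeg a)).
Proof.
have /= := thv (Quasi a b).
by case: (v a b); case: (v _ _).
Qed.

(** Adding a disjoint event [d] to [x] and [y] changes neither [x \ y] nor
    [y \ x], on which alone the comparison depends. *)
Lemma cmp_add_same d x y x' y' :
  (forall w, (beval w x + beval w d = beval w x')%N) ->
  (forall w, (beval w y + beval w d = beval w y')%N) ->
  v x' y' = v x y.
Proof.
move=> hx hy; rewrite cmp_quasi [RHS]cmp_quasi.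
apply: cmp_congr => w /=; move: (hx w) (hy w);
by case: (beval w x) (beval w d) (beval w x') (beval w y) (beval w y')
  => [] [] [] [] [].
Qed.

(** The second conjunct says that strictness is additive as well: if the sums
    are equally likely, so are the summands. *)
Lemma cmp_add x1 x2 x y1 y2 y :
  (forall w, (beval w x1 + beval w x2 = beval w x)%N) ->
  (forall w, (beval w y1 + beval w y2 = beval w y)%N) ->
  v x1 y1 -> v x2 y2 -> v x y /\ (v y x -> v y1 x1 /\ v y2 x2).
Proof.
move=> hx hy h1 h2.
(* [x1 + x2 \ y1 >= y1 + x2 \ y1 = x2 + y1 \ x2 >= y2 + y1 \ x2], and the
   intersection of [x2] and [y1] completes the two ends to [x] and [y]. *)
pose l := BAnd x2 (BNeg y1); pose r := BAnd y1 (BNeg x2).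
pose m := BNeg (BAnd (BNeg x2) (BNeg y1)).
pose p := BNeg (BAnd (BNeg x1) (BNeg l)).
pose q := BNeg (BAnd (BNeg y2) (BNeg r)).
have pm : v p m = v x1 y1.
  apply: (@cmp_add_same l) => w /=; move: (hx w) (hy w);
  by case: (beval w x1) (beval w x2) (beval w x) (beval w y1) => [] [] [] [].
have mp : v m p = v y1 x1.
  apply: (@cmp_add_same l) => w /=; move: (hx w) (hy w);
  by case: (beval w x1) (beval w x2) (beval w x) (beval w y1) => [] [] [] [].
have mq : v m q = v x2 y2.
  apply: (@cmp_add_same r) => w /=; move: (hx w) (hy w);
  by case: (beval w y1) (beval w y2) (beval w y) (beval w x2) => [] [] [] [].
have qm : v q m = v y2 x2.
  apply: (@cmp_add_same r) => w /=; move: (hx w) (hy w);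
  by case: (beval w y1) (beval w y2) (beval w y) (beval w x2) => [] [] [] [].
have xy : v x y = v p q.
  apply: (@cmp_add_same (BAnd x2 y1)) => w /=; move: (hx w) (hy w);
  by case: (beval w y1) (beval w y2) (beval w y) (beval w x2) (beval w x1)
    (beval w x) => [] [] [] [] [] [].
have yx : v y x = v q p.
  apply: (@cmp_add_same (BAnd x2 y1)) => w /=; move: (hx w) (hy w);
  by case: (beval w y1) (beval w y2) (beval w y) (beval w x2) (beval w x1)
    (beval w x) => [] [] [] [] [] [].
rewrite -pm in h1; rewrite -mq in h2; rewrite xy yx -mp -qm; split.
  exact: cmp_trans h1 h2.
move=> qp; split; first exact: cmp_trans h2 qp.
exact: cmp_trans qp h1.
Qed.

(** The form of finite additivity from which the cancellation law is derived;
    the converse comparison is again inherited by all summands. *)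
Lemma cmp_sum (T : eqType) (r : seq T) (X Y : T -> bform L) x y :
  (forall w, (\sum_(i <- r) beval w (X i) = beval w x)%N) ->
  (forall w, (\sum_(i <- r) beval w (Y i) = beval w y)%N) ->
  (forall i, i \in r -> v (X i) (Y i)) ->
  v x y /\ (v y x -> forall i, i \in r -> v (Y i) (X i)).
Proof.
elim: r x y => [|i r IHr] x y hx hy XY.
  split=> //; apply: cmp_mono => w.
  by have := hy w; rewrite big_nil; case: (beval w y).
pose x' := BAnd x (BNeg (X i)); pose y' := BAnd y (BNeg (Y i)).
have hx' w : (\sum_(j <- r) beval w (X j) = beval w x')%N.
  have := hx w; rewrite big_cons /=.
  by case: (beval w (X i)) (beval w x) => [] [] //; rewrite add1n => -[].
have hy' w : (\sum_(j <- r) beval w (Y j) = beval w y')%N.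
  have := hy w; rewrite big_cons /=.
  by case: (beval w (Y i)) (beval w y) => [] [] //; rewrite add1n => -[].
have [|x'y' y'x'] := IHr x' y' hx' hy'.
  by move=> j jr; apply: XY; rewrite inE jr orbT.
have [|||//|xy yx] := @cmp_add (X i) x' x (Y i) y' y.
- by move=> w; rewrite -hx' -hx big_cons.
- by move=> w; rewrite -hy' -hy big_cons.
- by apply: XY; rewrite mem_head.
split=> // /yx[YX /y'x' h] j; rewrite inE => /predU1P[->//|]; exact: h.
Qed.

(** If some part of [x] were less likely than some part of [y], every part of
    [x] would be less likely than every part of [y], and so would be [x] than
    [y], by strict additivity. *)
Lemma cmp_div (J : finType) (X Y : J -> bform L) x y :
  (forall w, (\sum_j beval w (X j) = beval w x)%N) ->
  (forall w, (\sum_j beval w (Y j) = beval w y)%N) ->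
  (forall i j, v (X i) (X j)) -> (forall i j, v (Y i) (Y j)) ->
  v x y -> forall i j, v (X i) (Y j).
Proof.
move=> hx hy XX YY xy i j; have [//|] := boolP (v (X i) (Y j)).
move=> nXY; have YX k : v (Y k) (X k).
  apply: (cmp_trans (YY k j)); apply: (cmp_trans _ (XX i k)).
  by have := cmp_total (X i) (Y j); rewrite (negPf nXY).
have [_ /(_ xy) XY] := cmp_sum hy hx (fun k _ => YX k).
rewrite -(negPf nXY); apply: (cmp_trans _ (YY i j)).
by apply: XY; rewrite mem_index_enum.
Qed.

End QualitativeProbability.

(** * Equipartitions obtained by polarization *)

Section Polarization.
Local Open Scope classical_set_scope.
Variable L : Type.

Lemma bletters_finite (a : bform L) : finite_set (bletters a).
Proof. by elim: a => [p|a IHa|a IHa b IHb] //=; rewrite finite_setU. Qed.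

Lemma cletters_finite (f : cform L) : finite_set (cletters f).
Proof.
elim: f => [a b|f IHf|f IHf g IHg] //=; rewrite finite_setU //.
by split; apply: bletters_finite.
Qed.

Hypothesis L_infinite : infinite_set [set: L].

Lemma underivable_polarize (a : bform L) (f : cform L) : ~ AXcomp f ->
  exists p, ~ AXcomp
    (cimp (capprox (BAnd a (BVar p)) (BAnd a (BNeg (BVar p)))) f).
Proof.
move=> nf; have [|p [_ /not_orP[pa pf]]] := @infinite_setN0 L
    ([set: L] `\` (bletters a `|` cletters f)).
  apply: infinite_setD => //; rewrite finite_setU; split.
    exact: bletters_finite.
  exact: cletters_finite.
by exists p => /(Polarize pa pf).
Qed.

(** Polarization replaces an underivable formula [f] by an underivable [f'] of
    the form [h -> f], where [h] states that certain events are equally likely.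
    A truth assignment refuting [f'] then satisfies [h] and refutes [f]. These
    two effects are all that is recorded of [f'], the first one as equality of
    the parts [e i] of [a], the second one as [f'] being a weakening of [f]. *)
Definition equipartition (J : finType) (a : bform L) (f' : cform L)
    (e : J -> bform L) :=
  (forall w, (\sum_j beval w (e j) = beval w a)%N) /\
  (forall v, theorem_valuation v -> ceval v f' = false ->
    forall i j, v (e i) (e j)).

Definition weakening (f f' : cform L) :=
  forall v, ceval v f' = false -> ceval v f = false.

(** Halving [a] and then partitioning both halves, recursively, gives [2 ^ n]
    parts. The type of indices is chosen before [a] and [f], because slices of
    events collect parts of equal index from different events. *)
Lemma underivable_equipartition (n : nat) : exists J : finType,
  (n < #|J|)%N /\ forall a f, ~ AXcomp f -> exists (e : J -> bform L) f',
    [/\ ~ AXcomp f', weakening f f' & equipartition a f' e].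
Proof.
elim: n => [|n [J [nJ IHn]]].
  exists unit; rewrite card_unit; split=> // a f nf.
  exists (fun=> a), f; split=> //; split.
    by move=> w; rewrite (big_pred1 tt) //; case.
  by move=> v thv _ _ _; apply: cmp_mono.
exists (bool * J)%type; split.
  rewrite card_prod card_bool mul2n -addnn -addn1 leq_add //.
  exact: leq_trans nJ.
move=> a f nf; have [p nf1] := underivable_polarize a nf.
set a1 := BAnd a (BVar p) in nf1; set a0 := BAnd a _ in nf1.
have [e1 [f2 [nf2 f12 [e1a e1v]]]] := IHn a1 _ nf1.
have [e0 [f3 [nf3 f23 [e0a e0v]]]] := IHn a0 _ nf2.
exists (fun bj => if bj.1 then e1 bj.2 else e0 bj.2), f3; split=> //.
  move=> v /f23 /f12 /=.
  by case: (ceval v f) => //; rewrite andbF.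
split.
  move=> w; rewrite -(pair_bigA _ (fun (b : bool) j =>
    beval w (if b then e1 j else e0 j) : nat)) big_bool /= e1a e0a /=.
  by case: (beval w a) (w p) => [] [].
move=> v thv vf3; have {e1v} e1v := e1v v thv (f23 _ vf3).
have {e0v} e0v := e0v v thv vf3.
have /andP[v10 v01] : v a1 a0 && v a0 a1.
  have /= := f12 _ (f23 _ vf3); by case: (v a1 a0); case: (v a0 a1).
move=> [[] i] [[] j] //=; first exact: (cmp_div thv e1a e0a).
exact: (cmp_div thv e0a e1a).
Qed.

Lemma underivable_equipartitions (S : finType) (c : S -> bform L) (n : nat) f :
  ~ AXcomp f -> exists (J : finType) (e : S -> J -> bform L) f',
    [/\ (n < #|J|)%N, ~ AXcomp f', weakening f f' &
        forall s, equipartition (c s) f' (e s)].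
Proof.
move=> nf; have [J [nJ split_J]] := underivable_equipartition n; exists J.
suff [e [f' [nf' ff' He]]] : exists (e : S -> J -> bform L) f',
  [/\ ~ AXcomp f', weakening f f' &
      forall s, s \in enum S -> equipartition (c s) f' (e s)].
  by exists e, f'; split=> // s; apply: He; rewrite mem_enum.
elim: (enum S) => [|s r [e [f1 [nf1 ff1 He]]]].
  by exists (fun s _ => c s), f; split=> // v.
have [e1 [f2 [nf2 f12 [e1s e1v]]]] := split_J (c s) _ nf1.
exists (fun t => if t == s then e1 else e t), f2; split=> //.
  by move=> v /f12 /ff1.
move=> t; rewrite inE; case: eqVneq => [->//|_ /= /He [ec ev]]; split=> //.
by move=> v thv /f12; apply: ev.
Qed.

End Polarization.

(** * Finite cancellation *)

(** The letter [p] is there to write the empty disjunction, for want of a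
    primitive contradiction. *)
Definition bunion (L : Type) (p : L) (T : finType) (A : {set T})
    (X : T -> bform L) : bform L :=
  foldr (fun i b => BNeg (BAnd (BNeg (X i)) (BNeg b)))
    (BAnd (BVar p) (BNeg (BVar p))) (enum A).

Lemma beval_bunion (L : Type) (p : L) (T : finType) (A : {set T})
    (X : T -> bform L) w :
  beval w (bunion p A X) = [exists i in A, beval w (X i)].
Proof.
transitivity (has (fun i => beval w (X i)) (enum A)).
  rewrite /bunion; elim: (enum A) => [|i r IHr] /=; first by rewrite andbN.
  by rewrite -IHr negb_and !negbK.
apply/hasP/existsP => [[i]|[i /andP[iA wi]]].
  by rewrite mem_enum => iA wi; exists i; rewrite iA.
by exists i; rewrite ?mem_enum.
Qed.

Lemma bunion_sum (L : Type) (p : L) (T : finType) (A : {set T})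
    (X : T -> bform L) w : (\sum_(i in A) beval w (X i) <= 1)%N ->
  (\sum_(i in A) beval w (X i))%N = beval w (bunion p A X).
Proof.
rewrite beval_bunion; case: existsP => [[i /andP[iA wi]]|none] le1.
  by apply/eqP; rewrite eqn_leq le1 (bigD1 i) //= wi.
rewrite big1 // => i iA; case: (boolP (beval w (X i))) => // wi.
by case: none; exists i; rewrite iA.
Qed.

Lemma cimps_false (L : Type) (T : Type) (h : T -> cform L) (g : cform L)
    (r : seq T) v :
  ceval v (foldr (fun i f => cimp (h i) f) g r) = false <->
  all (fun i => ceval v (h i)) r /\ ceval v g = false.
Proof.
elim: r => [|i r IHr] /=; first by split=> [|[]].
case: (ceval v (h i)) => //=.
  by rewrite negbK; exact: IHr.
by split=> // -[].
Qed.

Lemma leq_sum_subset (T : finType) (A : {set T}) (F : T -> nat) :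
  (\sum_(i in A) F i <= \sum_i F i)%N.
Proof. by rewrite [leqRHS](bigID (mem A)) leq_addr. Qed.

Local Open Scope set_scope.

Section CancellationFromPieces.
Variables (L : Type) (v : bform L -> bform L -> bool) (p : L).
Hypothesis thv : theorem_valuation v.

Lemma cmp_sum_set (T : finType) (A : {set T}) (X Y : T -> bform L) x y :
  (forall w, (\sum_(i in A) beval w (X i))%N = beval w x) ->
  (forall w, (\sum_(i in A) beval w (Y i))%N = beval w y) ->
  (forall i, i \in A -> v (X i) (Y i)) ->
  v x y /\ (v y x -> forall i, i \in A -> v (Y i) (X i)).
Proof.
move=> hx hy XY; have [|||xy yx] := @cmp_sum _ _ thv _ (enum A) X Y x y.
- by move=> w; rewrite big_enum.
- by move=> w; rewrite big_enum.
- by move=> i; rewrite mem_enum; exact: XY.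
by split=> // /yx h i iA; apply: h; rewrite mem_enum.
Qed.

Lemma cmp_equal_card (T : finType) (A B : {set T}) (X : T -> bform L) x y :
  (forall i j, v (X i) (X j)) -> #|A| = #|B| ->
  (forall w, (\sum_(i in A) beval w (X i))%N = beval w x) ->
  (forall w, (\sum_(i in B) beval w (X i))%N = beval w y) ->
  v x y.
Proof.
move=> XX AB hx hy; have [/eqP|] := posnP #|A|.
  rewrite cards_eq0 => /eqP A0; move: AB hx hy; rewrite A0 cards0 => /esym/eqP.
  rewrite cards_eq0 => /eqP -> hx hy; apply: cmp_mono => // w.
  by have := hy w; rewrite big_set0; case: (beval w y).
move=> /card_gt0P [i0 _].
have [] // := @cmp_sum _ _ thv _ (index_iota 0 #|A|)
  (fun t => X (nth i0 (enum A) t)) (fun t => X (nth i0 (enum B) t)) x y.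
- by move=> w; rewrite -hx -[RHS]big_enum [RHS](big_nth i0) -cardE.
- by move=> w; rewrite -hy -[RHS]big_enum [RHS](big_nth i0) -cardE AB.
Qed.

(* [e s j] is the [j]-th piece of the atom [c s]. *)
Variables (S J : finType) (c : S -> bform L) (e : S -> J -> bform L).
Hypothesis disjoint_c : forall w, (\sum_s beval w (c s) <= 1)%N.
Hypothesis partition_e : forall w s, (\sum_j beval w (e s j))%N = beval w (c s).
Hypothesis equal_e : forall s i j, v (e s i) (e s j).

Implicit Type A : {set S}.

Let slice (A : {set S}) (j : J) := bunion p A (e^~ j).

Lemma sum_pieces_le1 w : (\sum_s \sum_j beval w (e s j) <= 1)%N.
Proof.
by under eq_bigr do rewrite partition_e; exact: disjoint_c.
Qed.

Lemma slice_sum A j w :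
  (\sum_(s in A) beval w (e s j))%N = beval w (slice A j).
Proof.
apply: bunion_sum; apply: leq_trans (sum_pieces_le1 w).
apply: leq_trans (leq_sum_subset _ _) _; apply: leq_sum => s _.
by rewrite (bigD1 j) //= leq_addr.
Qed.

Lemma slices_sum A w :
  (\sum_j beval w (slice A j))%N = beval w (bunion p A c).
Proof.
under eq_bigr do rewrite -slice_sum.
rewrite exchange_big /=; under eq_bigr do rewrite partition_e.
apply: bunion_sum; apply: leq_trans (disjoint_c w).
exact: leq_sum_subset.
Qed.

Lemma cmp_slice A i j : v (slice A i) (slice A j).
Proof.
have [] // := @cmp_sum_set S A (e^~ i) (e^~ j) (slice A i) (slice A j).
- by move=> w; rewrite slice_sum.
- by move=> w; rewrite slice_sum.
Qed.

(** The comparison of [A i] with [B i] is transferred to their slices of index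
    [k i]. These are disjoint for different [i], and the two unions of slices
    have equally many pieces of each atom [s], namely one for each [i] with
    [s \in A i] and with [s \in B i] respectively. As the unions are therefore
    equally likely, strict additivity turns all the comparisons around. *)
Lemma cancellation_equipartition (N : nat) (A B : 'I_N -> {set S}) :
  (N <= #|J|)%N ->
  (forall s, #|[set i | s \in A i]| = #|[set i | s \in B i]|) ->
  (forall i, v (bunion p (A i) c) (bunion p (B i) c)) ->
  forall i, v (bunion p (B i) c) (bunion p (A i) c).
Proof.
move=> NJ balanced AB i.
pose k (i : 'I_N) : J := enum_val (widen_ord NJ i).
have k_inj : injective k by move=> a b /enum_val_inj [] /val_inj.
have sum_k (F : J -> nat) : (\sum_i F (k i) <= \sum_j F j)%N.
  apply: leq_trans (leq_sum_subset (k @: [set: _]) F).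
  rewrite big_imset /=; last by move=> a b _ _; exact: k_inj.
  by apply: eq_leq; apply: eq_bigl => i0; rewrite inE.
have sum_piece_k w s :
    (\sum_i beval w (e s (k i)) <= \sum_j beval w (e s j))%N.
  exact: (sum_k (fun j => beval w (e s j) : nat)).
(* The pieces in the slices of the [D i], grouped by atom and altogether. *)
pose atom_union (D : 'I_N -> {set S}) s :=
  bunion p [set i | s \in D i] (fun i => e s (k i)).
pose union (D : 'I_N -> {set S}) :=
  bunion p [set: 'I_N] (fun i => slice (D i) (k i)).
have atom_unionE (D : 'I_N -> {set S}) s w :
    (\sum_(i in [set i | s \in D i]) beval w (e s (k i)))%N =
    beval w (atom_union D s).
  apply: bunion_sum; apply: leq_trans (sum_pieces_le1 w).
  apply: leq_trans (leq_sum_subset _ _) _; rewrite (bigD1 s) //=.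
  exact: leq_trans (leq_addr _ _).
have regroup (D : 'I_N -> {set S}) w :
    (\sum_(i in [set: 'I_N]) beval w (slice (D i) (k i)) =
     \sum_s beval w (atom_union D s))%N.
  under eq_bigr do rewrite -slice_sum.
  rewrite (exchange_big_dep predT) //=; apply: eq_bigr => s _.
  by rewrite -atom_unionE; apply: eq_bigl => j; rewrite !inE.
have union_atoms (D : 'I_N -> {set S}) w :
    (\sum_(s in [set: S]) beval w (atom_union D s))%N = beval w (union D).
  rewrite -bunion_sum regroup; first by apply: eq_bigl => s; rewrite inE.
  apply: leq_trans (sum_pieces_le1 w); apply: leq_sum => s _.
  by rewrite -atom_unionE; apply: leq_trans (leq_sum_subset _ _) _.
have union_slices (D : 'I_N -> {set S}) w :
    (\sum_(i in [set: 'I_N]) beval w (slice (D i) (k i)))%N =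
    beval w (union D).
  by rewrite regroup -union_atoms; apply: eq_bigl => s; rewrite inE.
have atom_unionBA s : v (atom_union B s) (atom_union A s).
  by apply: (cmp_equal_card (X := fun i => e s (k i)) _ (esym (balanced s))).
have sliceAB i0 : v (slice (A i0) (k i0)) (slice (B i0) (k i0)).
  apply: (cmp_div thv (slices_sum (A i0)) (slices_sum (B i0))) (AB i0) _ _.
    exact: cmp_slice.
  exact: cmp_slice.
have [BA _] :=
  cmp_sum_set (union_atoms B) (union_atoms A) (fun s _ => atom_unionBA s).
have [_ /(_ BA) sliceBA] :=
  cmp_sum_set (union_slices A) (union_slices B) (fun i _ => sliceAB i).
have [] // := @cmp_sum_set J [set: J] (slice (B i)) (slice (A i))
  (bunion p (B i) c) (bunion p (A i) c).
- by move=> w; rewrite -slices_sum; apply: eq_bigl => s; rewrite inE.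
- by move=> w; rewrite -slices_sum; apply: eq_bigl => s; rewrite inE.
move=> j _; apply: (cmp_trans thv (cmp_slice _ j (k i))).
apply: (cmp_trans thv _ (cmp_slice _ (k i) j)).
by apply: sliceBA; rewrite inE.
Qed.

End CancellationFromPieces.

(** The cancellation law for comparisons of unions of atoms is an implication
    [f] between comparisons. If [v] violated it, [f] would be underivable, and
    polarization would provide another assignment [u] that violates it and in
    which every atom has enough equally likely pieces. *)
Lemma finite_cancellation (L : Type)
    (L_infinite : infinite_set [set: L]%classic)
    (v : bform L -> bform L -> bool) (p : L) (S : finType) (c : S -> bform L)
    (N : nat) (A B : 'I_N -> {set S}) :
  theorem_valuation v -> (forall w, (\sum_s beval w (c s) <= 1)%N) ->
  (forall s, #|[set i | s \in A i]| = #|[set i | s \in B i]|) ->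
  (forall i, v (bunion p (A i) c) (bunion p (B i) c)) ->
  forall i, v (bunion p (B i) c) (bunion p (A i) c).
Proof.
move=> thv disjoint_c balanced AB i; apply/negPn/negP => nBA.
pose h i := CGe (bunion p (A i) c) (bunion p (B i) c).
pose g := CGe (bunion p (B i) c) (bunion p (A i) c).
pose f := foldr (fun i f => cimp (h i) f) g (enum 'I_N).
have nf : ~ AXcomp f.
  move=> /thv; suff -> : ceval v f = false by [].
  by apply/cimps_false; split; [apply/allP => j _; apply: AB|apply: negPf].
have [J [e [f' [NJ nf' ff' He]]]] :=
  underivable_equipartitions L_infinite c N nf.
have [u thu /[dup] uf' /ff' /cimps_false [/allP uAB uBA]] := lindenbaum nf'.
suff : u (bunion p (B i) c) (bunion p (A i) c).
  by rewrite -[u _ _]/(ceval u g) uBA.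
apply: (cancellation_equipartition thu disjoint_c) (ltnW NJ) balanced _ _ => //.
- by move=> w s; case: (He s).
- by move=> s; case: (He s) => _; apply.
- by move=> j; apply: uAB; rewrite mem_enum.
Qed.

(** * Fourier-Motzkin elimination *)

Section FourierMotzkin.
Variables (F : realFieldType) (S : finType).
Local Open Scope ring_scope.

Definition lt_or_le (strict : bool) (x y : F) : bool :=
  if strict then x < y else x <= y.

Lemma seq_argmax (T : eqType) (key : T -> F) (r : seq T) : r = [::] \/
  exists2 m, m \in r & forall l, l \in r -> key l <= key m.
Proof.
elim: r => [|a r [->|[m mr mmax]]]; [by left|right|right].
  by exists a; rewrite ?mem_head // => l; rewrite inE => /eqP ->.
have [am|ma] := lerP (key a) (key m).
  exists m; first by rewrite inE mr orbT.
  by move=> l; rewrite inE => /predU1P[->|/mmax].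
exists a; first exact: mem_head.
move=> l; rewrite inE => /predU1P[->//|/mmax/le_trans]; apply; exact: ltW.
Qed.

Lemma seq_argmin (T : eqType) (key : T -> F) (r : seq T) : r = [::] \/
  exists2 m, m \in r & forall l, l \in r -> key m <= key l.
Proof.
have [->|[m mr mmax]] := seq_argmax (fun l => - key l) r; [by left|right].
by exists m => // l /mmax; rewrite lerN2.
Qed.

(** The midpoint of the greatest lower bound and the least upper bound meets
    all bounds: when the two coincide, no bound of that value is strict, since
    it is paired with an opposite bound of the same value. *)
Lemma between (lo up : seq (F * bool)) :
  (forall l u, l \in lo -> u \in up -> lt_or_le (l.2 || u.2) l.1 u.1) ->
  exists x, (forall l, l \in lo -> lt_or_le l.2 l.1 x) /\
            (forall u, u \in up -> lt_or_le u.2 x u.1).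
Proof.
have weaken b x y : lt_or_le b x y -> x <= y by case: b => //= /ltW.
have strict b x y : x < y -> lt_or_le b x y by case: b => //= /ltW.
move=> lo_up; have [up0|[u uup umin]] := seq_argmin fst up.
  have [lo0|[l llo lmax]] := seq_argmax fst lo.
    by exists 0; rewrite up0 lo0.
  exists (l.1 + 1); rewrite up0; split=> // l' /lmax ll'; apply: strict; lra.
have [lo0|[l llo lmax]] := seq_argmax fst lo.
  exists (u.1 - 1); rewrite lo0; split=> // u' /umin uu'; apply: strict; lra.
have lu : l.1 <= u.1 by apply: weaken (lo_up _ _ llo uup).
exists ((l.1 + u.1) / 2); split=> [l' l'lo|u' u'up].
  have := lo_up _ _ l'lo uup; have := lmax _ l'lo.
  by case: l'.2 => /= h1 h2; lra.
have := lo_up _ _ llo u'up; have := umin _ u'up.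
by case: u'.2; rewrite ?orbT ?orbF /= => h1 h2; lra.
Qed.

(* A pair [(g, b)] stands for the inequality [0 <= dot g p], strict when [b]. *)
Notation ineq := ({ffun S -> int} * bool)%type.

Definition dot (g : {ffun S -> int}) (p : S -> F) : F :=
  \sum_s (g s)%:~R * p s.

Definition holds (p : S -> F) (c : ineq) : bool := lt_or_le c.2 0 (dot c.1 p).

(** The combinations of given inequalities with positive integer multipliers,
    which arise by repetition of summands. Integrality of the coefficients
    keeps elimination within these combinations, so that an inconsistency is
    witnessed by a finite list of the given inequalities. *)
Inductive sums (cs : seq ineq) : {ffun S -> int} -> bool -> Prop :=
| sums_in c : c \in cs -> sums cs c.1 c.2
| sums_add g b h b' : sums cs g b -> sums cs h b' -> sums cs (g + h) (b || b').

Lemma sums_muln cs g b n : sums cs g b -> sums cs (g *+ n.+1) b.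
Proof.
move=> gb; elim: n => [|n IHn]; first by rewrite mulr1n.
by rewrite mulrS -[b]orbb; apply: sums_add.
Qed.

Lemma sums_sub cs cs' : (forall c, c \in cs' -> sums cs c.1 c.2) ->
  forall g b, sums cs' g b -> sums cs g b.
Proof.
by move=> sub g b; elim=> [c /sub|? ? ? ? _ ? _ ?] //; apply: sums_add.
Qed.

(** The multipliers make the coefficients of [s] cancel when those of [c] and
    [d] have opposite signs. *)
Definition combine (s : S) (c d : ineq) : ineq :=
  (c.1 *+ `|d.1 s| + d.1 *+ `|c.1 s|, c.2 || d.2).

Definition eliminate (s : S) (cs : seq ineq) : seq ineq :=
  [seq c : ineq <- cs | c.1 s == 0] ++
  [seq combine s c d | c <- [seq c : ineq <- cs | 0 < c.1 s],
                       d <- [seq d : ineq <- cs | d.1 s < 0]].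

Lemma mem_eliminate s cs e : e \in eliminate s cs ->
  (e \in cs /\ e.1 s = 0) \/
  exists c d, [/\ c \in cs, d \in cs, 0 < c.1 s, d.1 s < 0 & e = combine s c d].
Proof.
rewrite mem_cat mem_filter => /orP[/andP[/eqP ? ?]|]; first by left.
move=> /allpairsP[[c d] /= []]; rewrite !mem_filter => /andP[? ?] /andP[? ?] ->.
by right; exists c, d.
Qed.

Lemma sums_eliminate s cs e : e \in eliminate s cs -> sums cs e.1 e.2.
Proof.
move=> /mem_eliminate[[ecs _]|[c [d [ccs dcs c0 d0 ->]]]]; first exact: sums_in.
have nz (z : int) : z != 0 -> exists n, `|z|%N = n.+1.
  by rewrite -absz_eq0; case: `|z|%N => // n; exists n.
have [n dn] := nz _ (ltr0_neq0 d0); have [m cm] := nz _ (lt0r_neq0 c0).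
by rewrite /combine dn cm; apply: sums_add; apply/sums_muln/sums_in.
Qed.

Lemma eliminate0 s cs e : e \in eliminate s cs -> e.1 s = 0.
Proof.
move=> /mem_eliminate[[_ //]|[c [d [_ _ c0 d0 ->]]]] /=.
rewrite ffunE !ffunMnE -[c.1 s *+ _]mulr_natr -[d.1 s *+ _]mulr_natr !natz.
by rewrite (gtz0_abs c0) (ltz0_abs d0) mulrN mulrC addNr.
Qed.

Definition update (p : S -> F) (s : S) (x : F) : S -> F :=
  fun t => if t == s then x else p t.

Lemma dot_update (g : {ffun S -> int}) p s x :
  dot g (update p s x) = dot g (update p s 0) + (g s)%:~R * x.
Proof.
rewrite /dot (bigD1 s) //= [in RHS](bigD1 s) //= /update eqxx mulr0 add0r addrC.
congr (_ + _).
by apply: eq_bigr => t /negPf ->.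
Qed.

Implicit Types (g h : {ffun S -> int}) (p q : S -> F).

Lemma dotD g h p : dot (g + h) p = dot g p + dot h p.
Proof.
rewrite /dot -big_split; apply: eq_bigr => s _.
by rewrite ffunE intrD mulrDl.
Qed.

Lemma dotMn g n p : dot (g *+ n) p = dot g p *+ n.
Proof.
rewrite /dot -sumrMnl; apply: eq_bigr => s _.
by rewrite ffunMnE -mulrnAl; congr (_ * _); exact: rmorphMn.
Qed.

(** Solved for the variable [s], each inequality of [cs] with a positive
    coefficient bounds it from below, each with a negative one from above, and
    the combination of the two states that the lower bound lies below the upper
    bound. *)
Lemma eliminate_solution s cs p :
  (forall e, e \in eliminate s cs -> holds p e) ->
  exists q, forall c, c \in cs -> holds q c.
Proof.
move=> pe; pose rest (g : {ffun S -> int}) := dot g (update p s 0).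
pose bound (c : ineq) := (- rest c.1 / (c.1 s)%:~R, c.2).
have rest0 g : g s = 0 -> dot g p = rest g.
  move=> gs; rewrite /rest /dot; apply: eq_bigr => t _; rewrite /update.
  by case: eqP => // ->; rewrite gs !mul0r.
have [l u|x [lo up]] := @between [seq bound c | c : ineq <- cs & 0 < c.1 s]
    [seq bound c | c : ineq <- cs & c.1 s < 0].
  move=> /mapP[c] + -> /mapP[d] + ->; rewrite !mem_filter.
  move=> /andP[c0 ccs] /andP[d0 dcs] /=.
  have ecs : combine s c d \in eliminate s cs.
    rewrite mem_cat; apply/orP; right; apply/allpairsP; exists (c, d).
    by rewrite /= !mem_filter c0 d0.
  have := pe _ ecs; rewrite /holds rest0 ?(eliminate0 ecs) //=.
  rewrite /rest dotD !dotMn -/(rest _) -/(rest _).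
  rewrite -[rest c.1 *+ _]mulr_natr -[rest d.1 *+ _]mulr_natr.
  have cF : 0 < (c.1 s)%:~R :> F by rewrite ltr0z.
  have dF : (d.1 s)%:~R < 0 :> F by rewrite ltrz0.
  have -> : `|c.1 s|%:R = (c.1 s)%:~R :> F by rewrite natr_absz gtr0_norm.
  have -> : `|d.1 s|%:R = - (d.1 s)%:~R :> F.
    by rewrite natr_absz ltr0_norm // intrN.
  set cs' := (c.1 s)%:~R in cF *; set ds' := (d.1 s)%:~R in dF *.
  have -> : - rest c.1 / cs' = (rest c.1 * - ds') / (cs' * ds').
    by field; rewrite ?(lt0r_neq0 cF) ?(ltr0_neq0 dF).
  have -> : - rest d.1 / ds' = - (rest d.1 * cs') / (cs' * ds').
    by field; rewrite ?(lt0r_neq0 cF) ?(ltr0_neq0 dF).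
  have cd0 : (cs' * ds')^-1 < 0 by rewrite invr_lt0 pmulr_rlt0.
  rewrite /lt_or_le; case: (c.2 || d.2); rewrite ?ltr_nM2r ?ler_nM2r //; lra.
exists (update p s x) => c ccs; rewrite /holds dot_update -/(rest c.1).
have [c0|c0|c0] := ltrgtP (c.1 s) 0.
- have cF : (c.1 s)%:~R < 0 :> F by rewrite ltrz0.
  have : bound c \in [seq bound c | c : ineq <- cs & c.1 s < 0].
    by apply: map_f; rewrite mem_filter c0.
  move=> /up; rewrite /lt_or_le /=; case: c.2.
    by rewrite ltr_ndivlMr //; lra.
  by rewrite ler_ndivlMr //; lra.
- have cF : 0 < (c.1 s)%:~R :> F by rewrite ltr0z.
  have : bound c \in [seq bound c | c : ineq <- cs & 0 < c.1 s].
    by apply: map_f; rewrite mem_filter c0.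
  move=> /lo; rewrite /lt_or_le /=; case: c.2.
    by rewrite ltr_pdivrMr //; lra.
  by rewrite ler_pdivrMr //; lra.
rewrite c0 mul0r addr0 -rest0 //; apply: pe.
by rewrite mem_cat mem_filter c0 eqxx ccs.
Qed.

(** The inequality [0 < 0] as a sum is the only obstacle, as elimination
    of all variables leaves inequalities without variables that are sums of the
    given ones. *)
Lemma fourier_motzkin (cs : seq ineq) : ~ sums cs 0 true ->
  exists p, forall c, c \in cs -> holds p c.
Proof.
suff ind (r : seq S) (ds : seq ineq) :
    (forall c, c \in ds -> forall s, s \notin r -> c.1 s = 0) ->
    ~ sums ds 0 true -> exists p, forall c, c \in ds -> holds p c.
  by apply: (ind (enum S)) => c _ s; rewrite mem_enum.
elim: r ds => [|s r IHr] ds supp nsums.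
  exists (fun=> 0) => -[g b] gds; have g0 : g = 0.
    by apply/ffunP => s; rewrite ffunE (supp _ gds).
  rewrite /holds /= /dot big1; last by move=> t _; rewrite mulr0.
  case: b gds => [gds|_]; last exact: lexx.
  by case: nsums; rewrite -g0; apply: (sums_in gds).
have [|nsums'|p] := IHr (eliminate s ds).
- move=> e eds t tr; have [->|ts] := eqVneq t s; first exact: eliminate0 eds.
  have tsr : t \notin s :: r by rewrite inE negb_or ts.
  have [[eds' _]|[c [d [cds dds _ _ ->]]]] := mem_eliminate eds.
    exact: supp eds' _ tsr.
  by rewrite /= ffunE !ffunMnE (supp _ cds t tsr) (supp _ dds t tsr) !mul0rn.
- by apply: nsums; apply: sums_sub nsums' => e; exact: sums_eliminate.
exact: eliminate_solution.
Qed.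

End FourierMotzkin.

(** * Representation by a probability model *)

(* The measure lives on [nat], all of whose subsets are measurable; point [k]
   stands for the [k]-th element of [S], and the points beyond have no mass. *)
Section DiscreteModel.
Local Open Scope classical_set_scope.
Local Open Scope ring_scope.
Variables (R : realType) (L : Type) (S : finType) (s0 : S) (q : S -> R).
Hypothesis q_ge0 : forall s, 0 <= q s.
Hypothesis q_sum1 : \sum_s q s = 1.
Variable W : S -> L -> bool.

Let point k := nth s0 (enum S) k.

Definition discrete_measure : set nat -> \bar R :=
  msum (fun k => mscale (NngNum (q_ge0 (point k))) (dirac k)) #|S|.

HB.instance Definition _ := Measure.on discrete_measure.

Let discrete_measureE (a : S -> bool) :
  discrete_measure [set k | a (point k)] = (\sum_(s | a s) q s)%:E.
Proof.
rewrite /discrete_measure /= /msum [RHS]/=.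
transitivity (\sum_(k < #|S|) (if a (point k) then q (point k) else 0)%:E)%E.
  apply: eq_bigr => k _; rewrite -[LHS]/(_%:E * \d_(k : nat) _)%E diracE.
  rewrite mem_setE -[_ \in _]/(a (point k)).
  by case: (a _); rewrite ?mule1 ?mule0.
rewrite sumEFin; congr (_%:E); rewrite [RHS]big_mkcond -[RHS]big_enum /=.
by rewrite (big_nth s0) big_mkord -cardE.
Qed.

Let discrete_measure_setT : discrete_measure setT = 1%E.
Proof.
have := discrete_measureE xpredT; rewrite q_sum1 => <-.
congr (discrete_measure _).
by apply/seteqP; split.
Qed.

HB.instance Definition _ :=
  Measure_isProbability.Build _ _ _ discrete_measure discrete_measure_setT.

Lemma discrete_model : exists M : prob_model R L, forall a,
  pm_prob M (pm_val M a) = (\sum_(s | beval (W s) a) q s)%:E.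
Proof.
have val_neg a : [set k | beval (W (point k)) (BNeg a)] =
    ~` [set k | beval (W (point k)) a].
  by apply/seteqP; split=> k /= /negP.
have val_and a b : [set k | beval (W (point k)) (BAnd a b)] =
    [set k | beval (W (point k)) a] `&` [set k | beval (W (point k)) b].
  by apply/seteqP; split=> k /= /andP.
exists (@ProbModel R L _ _ discrete_measure _ val_neg val_and (fun=> I)) => a.
exact: (discrete_measureE (fun s => beval (W s) a)).
Qed.

End DiscreteModel.

(* A cell of a list of letters is an assignment of truth values to its entries;
   when letters are repeated, some cells are inconsistent, hence empty. *)
Section Cells.
Variable L : Type.

Fixpoint bletter_seq (a : bform L) : seq L :=
  match a with
  | BVar p => [:: p]
  | BNeg a1 => bletter_seq a1
  | BAnd a1 a2 => bletter_seq a1 ++ bletter_seq a2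
  end.

Fixpoint cletter_seq (f : cform L) : seq L :=
  match f with
  | CGe a b => bletter_seq a ++ bletter_seq b
  | CNeg f1 => cletter_seq f1
  | CAnd f1 f2 => cletter_seq f1 ++ cletter_seq f2
  end.

Lemma eq_map_cat (T : Type) (w w' : T -> bool) (r1 r2 : seq T) :
  map w (r1 ++ r2) = map w' (r1 ++ r2) ->
  map w r1 = map w' r1 /\ map w r2 = map w' r2.
Proof.
rewrite !map_cat => /eqP; rewrite eqseq_cat ?size_map //.
by move=> /andP[/eqP ? /eqP].
Qed.

Lemma beval_eq (w w' : L -> bool) (a : bform L) :
  map w (bletter_seq a) = map w' (bletter_seq a) -> beval w a = beval w' a.
Proof.
elim: a => [p|a IHa|a IHa b IHb] /=; first by case.
  by move=> /IHa ->.
by move=> /eq_map_cat[/IHa -> /IHb ->].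
Qed.

Variable ls : seq L.
Notation cells := ((size ls).-tuple bool).

Definition cell_of (w : L -> bool) : cells := map_tuple w (in_tuple ls).

Definition cell_form (p : L) (s : cells) : bform L :=
  foldr (fun qb g => BAnd (if qb.2 then BVar qb.1 else BNeg (BVar qb.1)) g)
    (BNeg (BAnd (BVar p) (BNeg (BVar p)))) (zip ls s).

Lemma beval_cell_form p s w : beval w (cell_form p s) = (s == cell_of w).
Proof.
rewrite -val_eqE /= /cell_form; have := size_tuple s; move: (val s) => {s}.
elim: ls => [|q r IHr] [|b s] //=; first by rewrite andbN.
move=> [/IHr ->]; rewrite eqseq_cons; congr (_ && _).
by case: b => /=; case: (w q).
Qed.

(** A representative of the cell; the default value is taken by empty cells. *)
Definition cell_point (s : cells) : L -> bool :=
  xget (fun=> false) [set w | cell_of w = s]%classic.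

Lemma cell_pointK w : cell_of (cell_point (cell_of w)) = cell_of w.
Proof.
exact: (xgetI (P := [set w' | cell_of w' = cell_of w]%classic) _ erefl).
Qed.

End Cells.

Local Open Scope set_scope.
Local Open Scope ring_scope.

Section Representation.
Variables (R : realType) (L : Type).
Hypothesis L_infinite : infinite_set [set: L]%classic.
Variables (v : bform L -> bform L -> bool) (p : L).
Hypothesis thv : theorem_valuation v.
Variables (S : finType) (c : S -> bform L).
Hypothesis partition_c : forall w, (\sum_s beval w (c s) = 1)%N.

Implicit Types A B : {set S}.
Let U A := bunion p A c.
Let diff A B : {ffun S -> int} := [ffun s => (s \in A)%:R - (s \in B)%:R].
Let strict A B := ~~ v (U B) (U A).
(* The conditions on a measure to agree with [v]. *)
Let constraints :=
  [seq (diff AB.1 AB.2, strict AB.1 AB.2) |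
    AB <- enum {: {set S} * {set S}} & v (U AB.1) (U AB.2)].

Lemma sums_constraints g b : sums constraints g b ->
  exists r : seq ({set S} * {set S}),
    [/\ all (fun AB => v (U AB.1) (U AB.2)) r,
        g = \sum_(AB <- r) diff AB.1 AB.2 &
        b = has (fun AB => strict AB.1 AB.2) r].
Proof.
elim=> [e /mapP[AB]|g1 b1 g2 b2 _ [r1 [r1v -> ->]] _ [r2 [r2v -> ->]]].
  rewrite mem_filter => /andP[vAB _] ->; exists [:: AB].
  by rewrite /= vAB big_seq1 orbF.
by exists (r1 ++ r2); rewrite all_cat r1v r2v big_cat has_cat.
Qed.

(** A sum of constraints that vanishes at [s] contains as many [A] as [B] with
    [s] as an element, which is the hypothesis of finite cancellation. *)
Lemma constraints_consistent : ~ sums constraints 0 true.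
Proof.
move=> /sums_constraints[r [rv r0 /esym/hasP[AB /nthP - /(_ AB)[i ir <-]]]].
rewrite /strict => /negP; apply.
pose A i := (tnth (in_tuple r) i).1; pose B i := (tnth (in_tuple r) i).2.
have -> : nth AB r i = tnth (in_tuple r) (Ordinal ir) by rewrite (tnth_nth AB).
apply: (finite_cancellation L_infinite thv (A := A) (B := B)) => [w|s|j].
- by rewrite partition_c.
- have card_sum (D : 'I_(size r) -> {set S}) :
      #|[set i | s \in D i]|%:R = \sum_i (s \in D i)%:R :> int.
    rewrite -sum1_card natr_sum big_mkcond /=; apply: eq_bigr => j _.
    by rewrite inE; case: (s \in D j).
  have /ffunP/(_ s) := r0; rewrite (big_tnth _ _ r) sum_ffunE ffunE /=.
  under eq_bigr do rewrite ffunE.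
  rewrite sumrB -!card_sum => /esym/subr0_eq/eqP.
  by rewrite eqr_nat => /eqP.
by move/allP: rv; apply; apply: mem_tnth.
Qed.

Let dot_diff A B (x : S -> R) :
  dot (diff A B) x = \sum_(s in A) x s - \sum_(s in B) x s.
Proof.
rewrite /dot [in RHS]big_mkcond [X in _ - X]big_mkcond -sumrB /=.
apply: eq_bigr => s _; rewrite ffunE intrB mulrBl.
by case: (s \in A); case: (s \in B); rewrite ?mul1r ?mul0r.
Qed.

(** A solution of the constraints agrees with [v]; it is nonnegative because all
    events are at least as likely as the empty one, and can be normalized
    because the whole space is strictly more likely. *)
Lemma representation : exists q : S -> R,
  [/\ forall s, 0 <= q s, \sum_s q s = 1 &
      forall A B, v (U A) (U B) = (\sum_(s in B) q s <= \sum_(s in A) q s)].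
Proof.
have [x xsol] := fourier_motzkin R constraints_consistent.
have hold A B : v (U A) (U B) -> holds x (diff A B, strict A B).
  move=> vAB; apply: xsol; apply/mapP; exists (A, B) => //.
  by rewrite mem_filter mem_enum andbT.
have repr A B : v (U A) (U B) = (\sum_(s in B) x s <= \sum_(s in A) x s).
  apply/idP/idP => [/hold|].
    rewrite /holds /= dot_diff /lt_or_le.
    by case: strict; rewrite ?subr_gt0 ?subr_ge0 //; exact: ltW.
  apply: contraTT => nAB; have vBA : v (U B) (U A).
    by have := cmp_total thv (U A) (U B); rewrite (negPf nAB).
  have := hold _ _ vBA; rewrite /holds /= dot_diff /lt_or_le /strict nAB.
  by rewrite subr_gt0 ltNge.
have x_ge0 s : 0 <= x s.
  suff : v (U [set s]) (U finset.set0) by rewrite repr big_set0 big_set1.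
  apply: (cmp_mono thv) => w; rewrite !beval_bunion => /existsP[t].
  by rewrite inE.
have total_gt0 : 0 < \sum_s x s.
  have : ~~ v (U finset.set0) (U [set: S]).
    apply: (thv (NonDeg _ _)) => w; rewrite beval_bunion.
      by apply/existsP => -[s]; rewrite inE.
    apply/existsP; apply: contrapT => none; have := partition_c w.
    rewrite big1 // => s _; case: (boolP (beval w (c s))) => // ws.
    by case: none; exists s; rewrite inE.
  rewrite repr big_set0 -ltNge; congr (_ < _); apply: eq_bigl => s.
  by rewrite inE.
exists (fun s => x s / \sum_t x t); split=> [s||A B].
- by rewrite divr_ge0 // ltW.
- by rewrite -mulr_suml divff // lt0r_neq0.
- by rewrite -!mulr_suml ler_pM2r ?invr_gt0 // -repr.
Qed.

End Representation.

(** Every event occurring in [f] is the union of the cells of the letters of [f]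
    whose representatives satisfy it, so that a measure representing a
    refutation of [f] on the unions of cells yields a model that refutes [f]. *)
Lemma completeness (R : realType) (L : Type)
    (L_infinite : infinite_set [set: L]%classic) (f : cform L) :
  (forall M : prob_model R L, sat M f) -> AXcomp f.
Proof.
move=> valid; apply: contrapT => /lindenbaum[v thv vf].
have [p _] := infinite_setN0 L_infinite.
pose ls := cletter_seq f; pose c := cell_form (ls := ls) p.
have [w|q [q0 q1 repr]] := @representation R L L_infinite v p thv _ c.
  rewrite (bigD1 (cell_of ls w)) //= beval_cell_form eqxx big1 // => s.
  by rewrite beval_cell_form => /negPf ->.
have [M ME] :=
  discrete_model (cell_of ls (fun=> false)) q0 q1 (@cell_point L ls).
(* The premise on [g] says, in terms of truth values, that its letters occur in
   [ls]; it passes to subformulas. *)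
suff truth g : (forall w w' : L -> bool, map w ls = map w' ls ->
    map w (cletter_seq g) = map w' (cletter_seq g)) -> sat M g <-> ceval v g.
  by have [/(_ (valid M))] := truth f (fun _ _ => id); rewrite vf.
elim: g => [a b|g IHg|g IHg h IHh] /= det.
- have union a' : (forall w w' : L -> bool, map w ls = map w' ls ->
      map w (bletter_seq a') = map w' (bletter_seq a')) ->
      forall w, beval w a' =
        beval w (bunion p [set s | beval (cell_point s) a'] c).
    move=> det' w; rewrite beval_bunion.
    transitivity (beval (cell_point (cell_of ls w)) a').
      by apply/beval_eq/det'; have /(congr1 val) := cell_pointK ls w.
    apply/idP/existsP => [wa|[s]].
      by exists (cell_of ls w); rewrite inE wa beval_cell_form eqxx.
    by rewrite inE beval_cell_form => /andP[? /eqP <-].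
  have detab w w' (ww : map w ls = map w' ls) := eq_map_cat (det w w' ww).
  rewrite (cmp_congr thv (union a _) (union b _)); last first.
  + by move=> w w' /detab[].
  + by move=> w w' /detab[].
  have inS a' : \sum_(s in [set s | beval (cell_point s) a']) q s =
      \sum_(s | beval (cell_point s) a') q s.
    by apply: eq_bigl => s; rewrite inE.
  by rewrite repr !ME lee_fin !inS.
- by rewrite IHg //; split=> /negP.
- have detgh w w' (ww : map w ls = map w' ls) := eq_map_cat (det w w' ww).
  rewrite IHg ?IHh; [by split=> /andP| |].
  + by move=> w w' /detgh[].
  + by move=> w w' /detgh[].
Qed.

Local Open Scope classical_set_scope.

Theorem theorem5 (R : realType) (L : Type) (L_infinite : infinite_set [set: L])
    (f : cform L) :
  AXcomp f <-> forall M : prob_model R L, sat M f.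
Proof.
by split=> [/soundness sf M|valid]; [exact: sf | exact: completeness valid].
Qed.
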